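(* Let $(A,\cdot)$ be a finite group, let $\mathcal S^0_A$ be the set of all regular subsets $S\subset\operatorname{Hol}(A)$ with $(1_A,\operatorname{id}_A)\in S$, and regard $\mathcal S^0_A$ as the vertex set of the quiver that has, for every $S\in\mathcal S^0_A$ and every $(a,f)\in S$, exactly one arrow from $S$ to $(a,f)^{-1}S$. Let $N^A_1$ be the number of connected components of this quiver having exactly one vertex. Then $N^A_1$ is the number of binary operations $\bullet$ on $A$ such that $(A,\cdot,\bullet)$ is a skew brace.
   Context: $\operatorname{Hol}(A)=A\rtimes\operatorname{Aut}(A)$, with product $(a,f)(b,g)=(a\cdot f(b),fg)$. For $\alpha\in\operatorname{Hol}(A)$ and $S\subseteq\operatorname{Hol}(A)$, $\alpha S=\{\alpha\beta:\beta\in S\}$. A subset $S\subseteq\operatorname{Hol}(A)$ is regular if the projection $(a,f)\mapsto a$ restricts to a bijection $S\to A$. Connected components are taken in the undirected sense. A skew (left) brace $(A,\cdot,\bullet)$ is a set $A$ with two group operations $\cdot$ and $\bullet$ such that $a\bullet(b\cdot c)=(a\bullet b)\cdot a^{-1}\cdot(a\bullet c)$ for all $a,b,c\in A$, where $a^{-1}$ is the inverse with respect to $\cdot$. *)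

(* Defs.v *)
From HB Require Import structures.
From mathcomp Require Import all_boot all_fingroup.

Set Implicit Arguments.
Unset Strict Implicit.
Unset Printing Implicit Defensive.

Import GroupScope.

Section Holomorph.
Variable gT : finGroupType.

Definition hol : Type := {af : gT * {perm gT} | af.2 \in Aut [set: gT]}.
HB.instance Definition _ := SubFinite.on hol.

Definition hol_elt (af : hol) : gT := (val af).1.
Definition hol_aut (af : hol) : {perm gT} := (val af).2.

Lemma hol_autM (af : hol) : {morph hol_aut af : x y / x * y}.
Proof.
by move=> x y; have /Aut_morphic/morphicP := valP af; apply; rewrite inE.
Qed.

(* The product of {perm gT} is (s * t) x = t (s x); the composite fg,
   x |-> f (g x), is therefore [g * f]. *)
Fact hol_mul_subproof (x y : hol) :
  hol_aut y * hol_aut x \in Aut [set: gT].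
Proof. exact: groupM (valP y) (valP x). Qed.
Definition hol_mul (x y : hol) : hol :=
  exist _ (hol_elt x * hol_aut x (hol_elt y), hol_aut y * hol_aut x)
    (hol_mul_subproof x y).

Fact hol_one_subproof : (1 : {perm gT}) \in Aut [set: gT].
Proof. exact: group1. Qed.
Definition hol_one : hol := exist _ (1, 1) hol_one_subproof.

Fact hol_inv_subproof (x : hol) :
  (hol_aut x)^-1 \in Aut [set: gT].
Proof. by rewrite groupV; exact: (valP x). Qed.
Definition hol_inv (x : hol) : hol :=
  exist _ ((hol_aut x)^-1 (hol_elt x)^-1, (hol_aut x)^-1) (hol_inv_subproof x).

Fact hol_mulA : associative hol_mul.
Proof.
move=> x y z; apply/val_inj; rewrite /= /hol_elt /hol_aut /= mulgA.
by congr (_, _); rewrite permM hol_autM mulgA.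
Qed.

Fact hol_mul1 : left_id hol_one hol_mul.
Proof.
move=> x; apply/val_inj.
by rewrite /= /hol_elt /hol_aut /= perm1 mul1g mulg1 -surjective_pairing.
Qed.

Fact hol_mulV : left_inverse hol_one hol_inv hol_mul.
Proof.
move=> x; apply/val_inj; have M := @hol_autM (hol_inv x).
have f1 : hol_aut (hol_inv x) 1 = 1.
  by apply: (mulgI (hol_aut (hol_inv x) 1)); rewrite -M !mulg1.
by congr (_, _); rewrite ?mulgV // -M mulVg.
Qed.

HB.instance Definition _ := Finite_isGroup.Build hol hol_mulA hol_mul1 hol_mulV.

Lemma hol_eltM (x y : hol) :
  hol_elt (x * y) = hol_elt x * hol_aut x (hol_elt y).
Proof. by []. Qed.

Lemma hol_elt1 : hol_elt 1 = 1. Proof. by []. Qed.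
Lemma hol_aut1 : hol_aut 1 = 1. Proof. by []. Qed.

Definition regular_set (S : {set hol}) : bool :=
  dinjectiveb hol_elt S && (hol_elt @: S == [set: gT]).

Definition pointed_regular_set (S : {set hol}) : bool :=
  regular_set S && (1 \in S).

Lemma pointed_regular_translate (S : {set hol}) (x : hol) :
  pointed_regular_set S -> x \in S -> pointed_regular_set (x^-1 *: S).
Proof.
move=> /andP[/andP[/dinjectiveP injS /eqP imS] _] xS.
apply/andP; split; last by rewrite mem_lcoset invgK mulg1.
have injx : {in x^-1 *: S &, injective hol_elt}.
  move=> y z; rewrite !mem_lcoset invgK => yS zS eyz.
  by apply/(mulgI x)/injS; rewrite // !hol_eltM eyz.
apply/andP; split; first exact/dinjectiveP.
rewrite eqEcard subsetT (card_in_imset injx) card_lcoset.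
by rewrite -(card_in_imset injS) imS leqnn.
Qed.

End Holomorph.

Record quiver := Quiver {
  vertex : finType;
  arrow : finType;
  source : arrow -> vertex;
  target : arrow -> vertex
}.

Section Components.
Variable Q : quiver.

Definition adjacent : rel (vertex Q) := [rel v w |
  [exists e : arrow Q, [|| (source e == v) && (target e == w)
                         | (source e == w) && (target e == v)]]].

Definition components : {set {set vertex Q}} :=
  equivalence_partition (connect adjacent) [set: vertex Q].

End Components.

Section RegularQuiver.
Variable gT : finGroupType.

Definition regular_vertex : finType :=
  {S : {set hol gT} | pointed_regular_set S}.

Definition regular_arrow : finType :=
  {S : regular_vertex & {x : hol gT | x \in val S}}.

Definition regular_source (e : regular_arrow) : regular_vertex := tag e.

Definition regular_target (e : regular_arrow) : regular_vertex :=
  Sub ((val (tagged e))^-1 *: val (tag e))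
      (pointed_regular_translate (valP (tag e)) (valP (tagged e))).

Definition regular_quiver : quiver := Quiver regular_source regular_target.

End RegularQuiver.

Section SkewBrace.
Variable gT : finGroupType.
Implicit Type op : gT -> gT -> gT.

Definition is_group_op op : Prop :=
  associative op /\
  exists e : gT, [/\ left_id e op, right_id e op &
    forall a : gT, exists b : gT, op b a = e /\ op a b = e].

Definition is_skew_brace op : Prop :=
  is_group_op op /\
  forall a b c : gT, op a (b * c) = op a b * a^-1 * op a c.

(* Binary operations are represented by finite functions so that they can be
   counted; skew_braceP relates the boolean predicate to [is_skew_brace]. *)
Definition skew_brace (m : {ffun gT * gT -> gT}) : bool :=
  [&& [forall a, forall b, forall c, m (a, m (b, c)) == m (m (a, b), c)],
      [exists e, forall a, [&& m (e, a) == a, m (a, e) == a &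
         [exists b, (m (b, a) == e) && (m (a, b) == e)]]]
    & [forall a, forall b, forall c,
         m (a, b * c) == m (a, b) * a^-1 * m (a, c)]].

Lemma skew_braceP (m : {ffun gT * gT -> gT}) :
  reflect (is_skew_brace (fun a b => m (a, b))) (skew_brace m).
Proof.
apply: (iffP and3P) => [[/forallP A /existsP[e /forallP E] /forallP D]|].
  split; last by move=> a b c; have /forallP/(_ b)/forallP/(_ c)/eqP := D a.
  split; first by move=> a b c; have /forallP/(_ b)/forallP/(_ c)/eqP := A a.
  exists e; split=> a; have /and3P[/eqP El /eqP Er /existsP[b]] := E a => //.
  by case/andP=> /eqP ? /eqP ?; exists b.
case=> [[A [e [El Er V]]] D]; split.
- by do 3![apply/forallP => ?]; apply/eqP; exact: A.
- apply/existsP; exists e; apply/forallP => a; apply/and3P; split.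
  + exact/eqP/El.
  + exact/eqP/Er.
  + have [b [bl br]] := V a; apply/existsP; exists b.
    by rewrite bl br !eqxx.
- by do 3![apply/forallP => ?]; apply/eqP; exact: D.
Qed.

End SkewBrace.

(* Main.v *)
Require Import Defs.
From mathcomp Require Import all_boot all_fingroup.

(** A one-vertex component is a vertex [S] all of whose arrows are loops, i.e.
    [x^-1 S = S] for every [x] in [S]; since [1 \in S], this says that [S] is a
    subgroup of [Hol(A)].  A regular subgroup is the graph of a map
    [a |-> lambda_a] into [Aut(A)], and [a o b = a * lambda_a b] identifies
    the regular subgroups with the skew brace operations. *)

Set Implicit Arguments.
Unset Strict Implicit.
Unset Printing Implicit Defensive.

Section SingletonComponents.
Variable Q : quiver.

Definition isolated (v : vertex Q) : bool :=
  [forall w, adjacent v w ==> (w == v)].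

Lemma isolated_connect (v w : vertex Q) :
  isolated v -> connect (@adjacent Q) v w = (w == v).
Proof.
move=> /forallP iso_v; apply/idP/eqP => [/connectP[p] | ->]; last exact: connect0.
elim: p => [|u p IHp] //= /andP[vu pth] w_last.
by have /implyP/(_ vu)/eqP u_v := iso_v u; subst u; exact: IHp.
Qed.

(** The injective map sending [v] to [[set v]] carries the isolated vertices onto the one-vertex
    components. *)
Lemma card_singleton_components :
  #|[set C in components Q | #|C| == 1]| = #|[set v : vertex Q | isolated v]|.
Proof.
rewrite -[RHS](card_imset _ set1_inj); apply: eq_card => C.
rewrite inE; apply/andP/imsetP => [[/imsetP[u _ defC] /cards1P[v C1]] | [v]].
  have Cu : u \in C by rewrite defC !inE connect0.
  have u_v : u = v by move: Cu; rewrite C1 inE => /eqP.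
  subst v; exists u; rewrite // inE; apply/forallP => w; apply/implyP => uw.
  by rewrite -in_set1 -C1 defC !inE connect1.
rewrite inE => iso_v ->; split; last by rewrite cards1.
apply/imsetP; exists v; rewrite ?inE //.
by apply/setP => w; rewrite !inE isolated_connect.
Qed.

End SingletonComponents.

Section RegularSubgroups.
Import GroupScope.
Variable gT : finGroupType.
Implicit Types (S : {set hol gT}) (x y : hol gT) (m : {ffun gT * gT -> gT}).

Definition regular_subgroup S : bool := regular_set S && group_set S.

Lemma adjacent_regular (S T : regular_vertex gT) :
  reflect (exists2 x, x \in val S & val T = x^-1 *: val S)
          (@adjacent (regular_quiver gT) S T).
Proof.
apply: (iffP existsP) => [[[U [x xU]]] | [x xS defT]].
  case/orP=> /andP[/eqP /= US /eqP UT].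
    rewrite /regular_source /= in US; subst U.
    by exists x; rewrite // -UT.
  rewrite /regular_source /= in US; subst U.
  have defS : val S = x^-1 *: val T by rewrite -UT.
  (* An arrow can be reversed: if [S] is [x^-1 T], then [x^-1] lies in [S] because [1] lies in [T],
     and translating [S] by its inverse [x] gives back [T]. *)
  exists x^-1; last by rewrite defS invgK -lcosetM mulgV mul1g.
  have /andP[_ T1] := valP T.
  by rewrite defS mem_lcoset mulVg.
exists (Tagged (fun U : regular_vertex gT => {x : hol gT | x \in val U})
          (Sub x xS : {x : hol gT | x \in val S})).
apply/orP; left; rewrite /= /regular_source /= eqxx /=.
by apply/eqP/val_inj; rewrite /= defT.
Qed.

(** Equality of [S] with all its translates [x^-1 S] is closure under products, which together with
    [1] makes a subset of a finite group a subgroup. Conversely, closure gives only an inclusion of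
    [S] in [x^-1 S]; equal cardinalities do the rest. *)
Lemma isolated_regular (S : regular_vertex gT) :
  @isolated (regular_quiver gT) S = group_set (val S).
Proof.
have /andP[_ S1] := valP S.
apply/forallP/group_setP => [iso | [_ SM] T].
  split=> // x y xS yS.
  pose T : regular_vertex gT := Sub _ (pointed_regular_translate (valP S) xS).
  have ST : @adjacent (regular_quiver gT) S T.
    by apply/adjacent_regular; exists x.
  have /implyP/(_ ST)/eqP/(congr1 val) defS := iso T.
  by move: yS; rewrite -[in X in X -> _]defS mem_lcoset invgK.
apply/implyP => /adjacent_regular[x xS defT]; apply/eqP/val_inj.
rewrite defT; apply/esym/eqP; rewrite eqEcard card_lcoset leqnn andbT.
by apply/subsetP => y yS; rewrite mem_lcoset invgK SM.
Qed.

Lemma card_isolated_regular :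
  #|[set S : regular_vertex gT | @isolated (regular_quiver gT) S]| =
  #|[set S | regular_subgroup S]|.
Proof.
rewrite -[LHS](card_imset _ val_inj); apply: eq_card => S; rewrite inE.
apply/imsetP/andP => [[T] | [regS gS]].
  rewrite inE isolated_regular => gT' ->; split=> //.
  by have /andP[] := valP T.
have pS : pointed_regular_set S.
  by rewrite /pointed_regular_set regS; case/group_setP: gS.
by exists (Sub S pS); rewrite // inE isolated_regular.
Qed.

(** The graph of [a |-> lambda_a], where [lambda_a b = a^-1 * m (a, b)]. Stated as a condition on
    [x], it makes sense for every [m], even when some [lambda_a] is not an automorphism. *)
Definition brace_subgroup m : {set hol gT} :=
  [set x | [forall b, hol_elt x * hol_aut x b == m (hol_elt x, b)]].

Lemma brace_subgroupP m x :
  reflect (forall b, hol_elt x * hol_aut x b = m (hol_elt x, b))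
          (x \in brace_subgroup m).
Proof. by rewrite inE; exact: 'forall_eqP. Qed.

Lemma hol_eqP x y : hol_elt x = hol_elt y -> hol_aut x =1 hol_aut y -> x = y.
Proof.
move=> eqxy /permP eqf; apply/val_inj.
by rewrite [LHS]surjective_pairing [RHS]surjective_pairing; congr (_, _).
Qed.

Lemma brace_subgroup_inj m : {in brace_subgroup m &, injective (@hol_elt gT)}.
Proof.
move=> x y /brace_subgroupP mx /brace_subgroupP my exy.
by apply: hol_eqP => // b; apply: (mulgI (hol_elt x)); rewrite mx {2}exy my exy.
Qed.

(** The witness is [(a, lambda_a)]: the brace identity makes [lambda_a] multiplicative, and a left
    inverse of [a] for [m] makes it injective, hence a permutation. *)
Lemma brace_subgroup_ex m a :
  is_skew_brace (fun a b => m (a, b)) ->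
  exists2 x, x \in brace_subgroup m & hol_elt x = a.
Proof.
case=> [[mA [e [e1 _ mV]]] mD].
have lamM : {morph (fun b => a^-1 * m (a, b)) : b c / b * c}.
  by move=> b c; rewrite mD !mulgA.
have lamI : injective (fun b => a^-1 * m (a, b)).
  move=> b c /mulgI ebc; have [d [da _]] := mV a.
  by rewrite -[b]e1 -[c]e1 -da -!mA ebc.
have lamA : perm lamI \in Aut [set: gT].
  rewrite inE; apply/andP; split; first by apply/subsetP => b; rewrite inE.
  by apply/morphicP => b c _ _; rewrite !permE lamM.
exists (exist _ (a, perm lamI) lamA) => //.
by apply/brace_subgroupP => b; rewrite /hol_elt /hol_aut /= permE mulKVg.
Qed.

Lemma skew_brace_one m :
  is_skew_brace (fun a b => m (a, b)) -> forall b, m (1, b) = b.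
Proof.
case=> [[_ [e [e1 _ _]]] mD].
have e_1 : e = 1.
  (* At [e], [1], [1] the brace identity reads [1 = e^-1], so both operations have the same
     identity. *)
  have := mD e 1 1; rewrite mulg1 e1 mulg1 mul1g => eV.
  by apply: invg_inj; rewrite -eV invg1.
by rewrite -e_1.
Qed.

Lemma brace_subgroup_regular m :
  is_skew_brace (fun a b => m (a, b)) -> regular_subgroup (brace_subgroup m).
Proof.
move=> brm; apply/andP; split.
  apply/andP; split; first exact/dinjectiveP/brace_subgroup_inj.
  rewrite eqEsubset subsetT; apply/subsetP => a _.
  by have [x xS <-] := brace_subgroup_ex a brm; exact: imset_f.
apply/group_setP; split.
  by apply/brace_subgroupP => b; rewrite perm1 mul1g skew_brace_one.
move=> x y /brace_subgroupP mx /brace_subgroupP my.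
(* Closure under products amounts to associativity of [m]. *)
apply/brace_subgroupP => b; rewrite hol_eltM permM -mulgA -hol_autM my !mx.
by have [[mA _] _] := brm; rewrite mA.
Qed.

Lemma regular_subgroup_brace S :
  regular_subgroup S ->
  exists2 m : {ffun gT * gT -> gT},
    is_skew_brace (fun a b => m (a, b)) & S = brace_subgroup m.
Proof.
case/andP=> [/andP[/dinjectiveP Sinj /eqP Sim] gS].
have [S1 SM] := group_setP gS.
have SV x : x \in S -> x^-1 \in S by exact: (@groupVr _ (Group gS)).
have Sex a : exists x, x \in S /\ hol_elt x = a.
  have: a \in hol_elt (gT := gT) @: S by rewrite Sim inE.
  by case/imsetP=> x xS ->; exists x.
have [h hP] := fin_all_exists Sex.
have hS a : h a \in S by case: (hP a).
have hK a : hol_elt (h a) = a by case: (hP a).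
have h_elt x : x \in S -> h (hol_elt x) = x by move=> xS; apply: Sinj.
(* With [h] inverse to the bijection [hol_elt] on [S], this is the group law of [S] transported to
   [gT]. The brace identity then follows from [mlam], since each [hol_aut (h a)] is
   multiplicative. *)
pose m : {ffun gT * gT -> gT} := [ffun p => hol_elt (h p.1 * h p.2)].
have mE a b : m (a, b) = hol_elt (h a * h b) by rewrite ffunE.
have hM a b : h (m (a, b)) = h a * h b by rewrite mE h_elt ?SM.
have mlam a b : m (a, b) = a * hol_aut (h a) b by rewrite mE hol_eltM !hK.
exists m.
  split; last by move=> a b c; rewrite !mlam hol_autM !mulgA mulgKV.
  split=> [a b c|]; first by rewrite mE hM [RHS]mE hM mulgA.
  have h1 : h 1 = 1 by exact: (h_elt 1).
  exists 1; split=> a; rewrite ?mE ?h1 ?mul1g ?mulg1 ?hK //.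
  exists (hol_elt (h a)^-1).
  by rewrite !mE h_elt ?SV // mulVg mulgV.
apply/setP => x; apply/idP/brace_subgroupP => [xS b | mx].
  by rewrite mlam h_elt.
rewrite -(_ : h (hol_elt x) = x) //; apply: hol_eqP => [|b]; first exact: hK.
by apply: (mulgI (hol_elt x)); rewrite mx mlam.
Qed.

Lemma card_regular_subgroups :
  #|[set S | regular_subgroup S]| =
  #|[set m : {ffun gT * gT -> gT} | skew_brace m]|.
Proof.
(* The subgroup determines [m]: it has an element over each [a], from which [m (a, b)] is read
   off. *)
have inj : {in [set m | skew_brace m] &, injective brace_subgroup}.
  move=> m1 m2; rewrite inE => /skew_braceP br1 _ eqS.
  apply/ffunP => -[a b]; have [x xS <-] := brace_subgroup_ex a br1.
  have /brace_subgroupP <- := xS.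
  by move: xS; rewrite eqS => /brace_subgroupP.
rewrite -[RHS](card_in_imset inj); apply: eq_card => S; rewrite inE.
apply/idP/imsetP => [/regular_subgroup_brace[m br ->] | [m]].
  by exists m => //; rewrite inE; apply/skew_braceP.
by rewrite inE => /skew_braceP br ->; exact: brace_subgroup_regular.
Qed.

End RegularSubgroups.

Theorem mainTheorem5 (gT : finGroupType) :
  #|[set C in components (regular_quiver gT) | #|C| == 1]| =
  #|[set m : {ffun gT * gT -> gT} | skew_brace m]|.
Proof.
rewrite card_singleton_components.
by rewrite -card_regular_subgroups -card_isolated_regular.
Qed.
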